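(* Let $d,k\geq2$. If $H\leq\mathrm{AAut}(\mathcal{T}_{d,k})$ is locally elliptic, commensurated in $\mathrm{AAut}(\mathcal{T}_{d,k})$, and $\mathrm{Aut}(\mathcal{T}_{d,k})\leq H$, then $H$ is compact.
   Context: $\mathcal{T}_{d,k}$ is the rooted tree whose root $r$ has degree $k$ and all other vertices have degree $d+1$. Its boundary $\partial\mathcal{T}_{d,k}$ is the set of rays $(r=\xi_0,\xi_1,\dots)$ with $\xi_{n+1}$ a child of $\xi_n$; with $N(\xi,\xi')$ the largest $n$ such that $\xi_n=\xi'_n$, put $\mathrm{dist}(\xi,\xi')=d^{-N(\xi,\xi')}$. A homothety is a map multiplying all distances by a fixed positive constant. An almost automorphism is a homeomorphism $g$ of $\partial\mathcal{T}_{d,k}$ for which there is a partition of $\partial\mathcal{T}_{d,k}$ into finitely many proper balls $B_1,\dots,B_n$ with each $g|_{B_i}:B_i\to g(B_i)$ a homothety. $\mathrm{AAut}(\mathcal{T}_{d,k})$ is the group of almost automorphisms with the locally compact group topology in which $\mathrm{Aut}(\mathcal{T}_{d,k})$ (automorphisms of the rooted tree, i.e. isometries of $\partial\mathcal{T}_{d,k}$) is a compact open subgroup. A subgroup is locally elliptic if the closed subgroup generated by any finite subset of it is compact. A subgroup $H\leq G$ is commensurated if $gHg^{-1}\cap H$ has finite index in both $H$ and $gHg^{-1}$ for every $g\in G$. *)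

(* Defs.v *)
From mathcomp Require Import all_boot.
From Stdlib Require Import Reals ClassicalEpsilon.

Set Implicit Arguments.
Unset Strict Implicit.
Unset Printing Implicit Defensive.

Section AAut.
Variables d k : nat.

(* A ray (r = xi_0, xi_1, ...) of T_{d,k} is encoded by the choice of one of
   the k children of the root, followed by an infinite sequence of choices
   among the d children of each subsequent vertex. *)
Definition Ray : Type := ('I_k * (nat -> 'I_d))%type.

(* agree n x y  <->  x_n = y_n  (the rays pass through the same vertex at level n) *)
Definition agree (n : nat) (x y : Ray) : Prop :=
  match n with
  | 0 => True
  | S m => x.1 = y.1 /\ forall j, (j < m)%N -> x.2 j = y.2 j
  end.

Definition Nis (x y : Ray) (n : nat) : Prop := agree n x y /\ ~ agree n.+1 x y.

(* dist x y = d^{-N(x,y)}, and 0 when x = y (N = infinity) *)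
Definition dist (x y : Ray) : R :=
  match excluded_middle_informative (exists n, Nis x y n) with
  | left H => Rinv (pow (INR d) (proj1_sig (constructive_indefinite_description _ H)))
  | right _ => 0%R
  end.

Definition ball (c : Ray) (r : R) : Ray -> Prop := fun y => (dist c y <= r)%R.

Definition continuous_map (f : Ray -> Ray) : Prop :=
  forall x (eps : R), (0 < eps)%R -> exists delta : R, (0 < delta)%R /\
    forall y, (dist x y < delta)%R -> (dist (f x) (f y) < eps)%R.

Definition homeomorphism (g : Ray -> Ray) : Prop :=
  exists ginv : Ray -> Ray, cancel g ginv /\ cancel ginv g /\
    continuous_map g /\ continuous_map ginv.

Definition homothety_on (B : Ray -> Prop) (g : Ray -> Ray) : Prop :=
  exists c : R, (0 < c)%R /\
    forall x y, B x -> B y -> dist (g x) (g y) = (c * dist x y)%R.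

Definition proper_ball (c : Ray) (r : R) : Prop :=
  (0 < r)%R /\ exists y, ~ ball c r y.

Definition IsAAut (g : Ray -> Ray) : Prop :=
  homeomorphism g /\
  exists (n : nat) (c : nat -> Ray) (r : nat -> R),
    (forall i, (i < n)%N -> proper_ball (c i) (r i)) /\
    (forall x, exists i, (i < n)%N /\ ball (c i) (r i) x) /\
    (forall i j x, (i < n)%N -> (j < n)%N -> i <> j ->
        ball (c i) (r i) x -> ball (c j) (r j) x -> False) /\
    (forall i, (i < n)%N -> homothety_on (ball (c i) (r i)) g).

(* automorphisms of the rooted tree = (surjective) isometries of the boundary *)
Definition IsAut (g : Ray -> Ray) : Prop :=
  bijective g /\ forall x y, dist (g x) (g y) = dist x y.

Definition Fix (n : nat) (a : Ray -> Ray) : Prop :=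
  IsAut a /\ forall x, agree n x (a x).

Definition gset := (Ray -> Ray) -> Prop.

(* the topology of AAut(T_{d,k}): the group topology in which Aut(T_{d,k}),
   with its usual (profinite) topology, is an open subgroup; a basis is given
   by the cosets g Fix_n, g in AAut *)
Definition IsOpen (U : gset) : Prop :=
  (forall g, U g -> IsAAut g) /\
  forall g, U g -> exists n, forall a, Fix n a -> U (g \o a).

Definition IsCompact (K : gset) : Prop :=
  (forall g, K g -> IsAAut g) /\
  forall (I : Type) (U : I -> gset),
    (forall i, IsOpen (U i)) ->
    (forall g, K g -> exists i, U i g) ->
    exists F : seq I, forall g, K g -> exists i, List.In i F /\ U i g.

Definition closure (A : gset) : gset :=
  fun g => IsAAut g /\ forall U, IsOpen U -> U g -> exists a, A a /\ U a.

Definition IsSubgroup (H : gset) : Prop :=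
  (forall g, H g -> IsAAut g) /\
  H (fun x => x) /\
  (forall g h, H g -> H h -> H (g \o h)) /\
  (forall g ginv, H g -> cancel g ginv -> cancel ginv g -> H ginv).

Definition generated (F : seq (Ray -> Ray)) : gset :=
  fun g => forall S, IsSubgroup S -> (forall f, List.In f F -> S f) -> S g.

Definition locally_elliptic (H : gset) : Prop :=
  forall F : seq (Ray -> Ray), (forall f, List.In f F -> H f) ->
    IsCompact (closure (generated F)).

Definition conjset (g : Ray -> Ray) (H : gset) : gset :=
  fun x => exists h ginv, H h /\ cancel g ginv /\ cancel ginv g /\
    x = g \o h \o ginv.

Definition finite_index (A B : gset) : Prop :=
  exists s : seq (Ray -> Ray), (forall t, List.In t s -> B t) /\
    forall b, B b -> exists t a, List.In t s /\ A a /\ b = t \o a.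

Definition commensurated (H : gset) : Prop :=
  forall g, IsAAut g ->
    finite_index (fun x => conjset g H x /\ H x) H /\
    finite_index (fun x => conjset g H x /\ H x) (conjset g H).

End AAut.

(* Main.v *)
(** Near each point [x], an almost automorphism [g] shifts the level at which two
    rays branch by an integer, its scale at [x]. Since [H] contains [Aut], an
    element of [H] of nonzero scale at [x] could be corrected to fix [x] and then
    iterated, contradicting local ellipticity; so [H] acts by local isometries.

    Conjugating by an almost automorphism that exchanges a ball of level [n] with
    one of level [n+1] and comparing scales, the finite index of [H] meet its
    conjugate makes the orbit of a ball under [H] finite: [H] is equicontinuous.

    The same conjugation shifts levels by one. Let [p] in [H] be supported in a
    small ball and move a pair of rays branching at level [m] to one branching at
    level [m']. Pigeonhole on the cosets, applied to products of disjoint copies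
    of [p], and a commutator with an isometry yield an element of [H] supported
    in a ball of the same level, and moving a pair from level [m+1] to level
    [m'+1]. As [Aut] is transitive on pairs branching at a given level, iterating
    contradicts equicontinuity unless [m = m']. Hence elements of [H] supported in
    a small ball are isometries.

    Finally let [h] in [H] and let [C] be a ball small enough for [h C] to lie in
    such a ball. Then [h] conjugates the isometries supported in [C] to
    isometries, which forces [h] to be isometric on [C]. So every element of [H]
    is isometric on balls of a fixed level, and compactness is Koenig's lemma. *)

From mathcomp Require Import zify perm.
From Stdlib Require Import ZArith Reals Lra.
From Stdlib Require Import Classical ClassicalEpsilon FunctionalExtensionality.
From mathcomp Require Import all_boot.
Require Import Defs.

Set Implicit Arguments.
Unset Strict Implicit.
Unset Printing Implicit Defensive.

Delimit Scope R_scope with R.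

(** * Uniform bounds and the pigeonhole principle *)

Lemma bound_on_prefix (P : nat -> nat -> Prop) n :
  (forall i m m', (m <= m')%N -> P i m -> P i m') ->
  (forall i, (i < n)%N -> exists m, P i m) ->
  exists m, forall i, (i < n)%N -> P i m.
Proof.
move=> mono; elim: n => [|n IHn] ex; first by exists 0.
have [i lt_in|m Pm] := IHn; first by apply: ex; lia.
have [m' Pm'] := ex n (ltnSn n).
exists (m + m')%N => i lt_i; case: (ltnP i n) => [/Pm|ge_in].
  by apply: mono; lia.
by have -> : i = n by [lia]; apply: mono Pm'; lia.
Qed.

Lemma bound_on_list (A : Type) (P : A -> nat -> Prop) (s : seq A) :
  (forall a m m', (m <= m')%N -> P a m -> P a m') ->
  (forall a, List.In a s -> exists m, P a m) ->
  exists m, forall a, List.In a s -> P a m.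
Proof.
move=> mono; elim: s => [|a s IHs] ex; first by exists 0.
have [b sb|m Pm] := IHs; first by apply: ex; right.
have [m' Pm'] := ex a (or_introl erefl).
exists (m + m')%N => b [<-|/Pm]; apply: mono; first exact: leq_addl.
  by [].
exact: leq_addr.
Qed.

Lemma list_pigeonhole (A : Type) (s : seq A) (col : nat -> A) :
  (forall i, (i <= size s)%N -> List.In (col i) s) ->
  exists i j, (i < j <= size s)%N /\ col i = col j.
Proof.
elim: s col => [|a s IHs] col ins; first by have /= := ins 0 isT.
case: (classic (exists i, (i < (size s).+1)%N /\ col i = col (size s).+1)).
  by move=> [i [lti eqi]]; exists i, (size s).+1; split=> //=; lia.
move=> nex; pose b := col (size s).+1.
(* The last colour [b] is now assumed not to occur earlier, so recolouring [a] as [b] on the earlier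
   indices merges no colours and leaves only colours of [s]. *)
have [i lij|i [j [lij eqij]]] :=
    IHs (fun i => if excluded_middle_informative (col i = a) then b else col i).
  rewrite /=; case: excluded_middle_informative => [ca|nca].
    have /= [eb|//] := ins (size s).+1 (leqnn _).
    by case: nex; exists i; split; [lia|rewrite ca].
  have /= [ea|//] := ins i ltac:(rewrite /=; lia).
  by case: nca.
exists i, j; split; first by rewrite /=; lia.
move: eqij; do 2!case: excluded_middle_informative.
- by move=> ej ei _; rewrite ei ej.
- by move=> ? ? /= e; case: nex; exists j; split; [lia|rewrite -e].
- by move=> ? ? /= e; case: nex; exists i; split; [lia|rewrite e].
by [].
Qed.

Section Boundary.
Variables d k : nat.
Hypotheses (d_gt1 : (1 < d)%N) (k_gt1 : (1 < k)%N).

Notation ray := (Ray d k).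
Implicit Types (x y z u v w : ray) (g h f a p : ray -> ray).

(** * Rays as sequences of digits *)

Definition digit x n : nat := if n is m.+1 then x.2 m else x.1.

Lemma agreeP n x y : agree n x y <-> forall j, (j < n)%N -> digit x j = digit y j.
Proof.
case: n => [|n] /=; first by split.
split=> [[e1 e2] [|j] lj /=|e]; [by rewrite e1|by rewrite e2|].
split; first by apply: val_inj; exact: (e 0).
by move=> j lj; apply: val_inj; exact: (e j.+1).
Qed.

Lemma ray_eqP x y : x = y <-> forall j, digit x j = digit y j.
Proof.
split=> [->//|]; case: x y => [x1 x2] [y1 y2] e; congr (_, _).
  by apply: val_inj; exact: (e 0).
by apply: functional_extensionality => j; apply: val_inj; exact: (e j.+1).
Qed.

Lemma agree0 x y : agree 0 x y. Proof. by []. Qed.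

Lemma agree_refl n x : agree n x x.
Proof. exact/agreeP. Qed.
Hint Resolve agree0 agree_refl : core.

Lemma agree_sym n x y : agree n x y -> agree n y x.
Proof. by move=> /agreeP e; apply/agreeP => j /e. Qed.

Lemma agree_trans n y x z : agree n x y -> agree n y z -> agree n x z.
Proof. by move=> /agreeP e /agreeP e'; apply/agreeP => j lj; rewrite e ?e'. Qed.

Lemma agree_le m n x y : (m <= n)%N -> agree n x y -> agree m x y.
Proof. by move=> le_mn /agreeP e; apply/agreeP => j lj; apply: e; lia. Qed.

Lemma agreeS n x y : agree n.+1 x y <-> agree n x y /\ digit x n = digit y n.
Proof.
split=> [e|[/agreeP e en]].
  by split; [exact: agree_le e|move/agreeP: e => ->].
by apply/agreeP => j; rewrite ltnS leq_eqVlt => /orP[/eqP->//|/e].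
Qed.

Lemma Nis_sym x y n : Nis x y n -> Nis y x n.
Proof. by move=> [e ne]; split; [exact: agree_sym|move/agree_sym]. Qed.

Lemma Nis_agree x y n m : Nis x y n -> agree m x y <-> (m <= n)%N.
Proof.
move=> [e ne]; split=> [em|le_mn]; last exact: agree_le e.
by rewrite leqNgt; apply/negP => lt_nm; apply: ne; exact: agree_le em.
Qed.

Lemma Nis_uniq x y n m : Nis x y n -> Nis x y m -> n = m.
Proof.
move=> Nn Nm; apply/eqP; rewrite eqn_leq.
by apply/andP; split; [apply/(Nis_agree _ Nm); case: Nn|apply/(Nis_agree _ Nn); case: Nm].
Qed.

Lemma Nis_ultra x y z n m : (n < m)%N -> Nis x y n -> agree m y z -> Nis x z n.
Proof.
move=> lt_nm [e ne] eyz; split.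
  by apply: agree_trans e _; apply: agree_le eyz; lia.
move=> exz; apply: ne; apply: agree_trans exz _.
by apply: agree_sym; apply: agree_le eyz; lia.
Qed.

Lemma not_agree_Nis n x y : ~ agree n x y -> exists i, (i < n)%N /\ Nis x y i.
Proof.
elim: n => [[]//|n IHn] ne.
case: (classic (agree n x y)) => [e|/IHn[i [lti Ni]]]; last by exists i; split; [lia|].
by exists n; split.
Qed.

Lemma eq_or_Nis x y : x = y \/ exists n, Nis x y n.
Proof.
case: (classic (forall n, agree n x y)) => [e|/not_all_ex_not[n]].
  by left; apply/ray_eqP => j; have /agreeP := e j.+1; apply.
by move=> /not_agree_Nis[i [_ Ni]]; right; exists i.
Qed.

Lemma Nis_irrefl x n : ~ Nis x x n.
Proof. by case=> _; apply. Qed.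

Lemma agree_iff_Nis x y x' y' :
  (forall n, agree n x y <-> agree n x' y') -> forall n, Nis x y n <-> Nis x' y' n.
Proof. by move=> e n; rewrite /Nis !e. Qed.


(** * Distances and isometries *)

Lemma d_gt0R : (0 < INR d)%R.
Proof. by apply: (lt_INR 0); lia. Qed.

Lemma d_gt1R : (1 < INR d)%R.
Proof. by apply: (lt_INR 1); lia. Qed.

Lemma dpow_gt0 n : (0 < INR d ^ n)%R.
Proof. exact: pow_lt d_gt0R. Qed.

Lemma dpow_le m n : (INR d ^ m <= INR d ^ n)%R <-> (m <= n)%N.
Proof.
have lt i j : (i < j)%N -> (INR d ^ i < INR d ^ j)%R.
  by move=> lij; apply: Rlt_pow; [exact: d_gt1R|lia].
split=> [le_mn|]; first by rewrite leqNgt; apply/negP => /lt; lra.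
rewrite leq_eqVlt => /orP[/eqP->|/lt]; lra.
Qed.

Lemma dpow_inj m n : (INR d ^ m = INR d ^ n)%R -> m = n.
Proof.
move=> e; have le1 : (m <= n)%N by apply/dpow_le; lra.
have le2 : (n <= m)%N by apply/dpow_le; lra.
by lia.
Qed.

Lemma dpow_inv_le m n : (/ INR d ^ m <= / INR d ^ n)%R <-> (n <= m)%N.
Proof.
rewrite -dpow_le; have := dpow_gt0 m; have := dpow_gt0 n => n0 m0.
split=> le_inv; last exact: Rinv_le_contravar.
rewrite -(Rinv_inv (INR d ^ n)) -(Rinv_inv (INR d ^ m)).
by apply: Rinv_le_contravar => //; apply: Rinv_0_lt_compat.
Qed.

Lemma dpow_inv_small (r : R) : (0 < r)%R -> exists n, (/ INR d ^ n < r)%R.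
Proof.
move=> r0; have := d_gt1R => d1.
have [|n /(_ n) small] := @pow_lt_1_zero (/ INR d)%R _ r r0.
  rewrite Rabs_right; last by apply: Rle_ge; apply: Rlt_le; apply: Rinv_0_lt_compat; lra.
  by rewrite -Rinv_1; apply: Rinv_lt_contravar; lra.
exists n; have := small ltac:(lia); rewrite pow_inv.
by have := Rle_abs (/ INR d ^ n)%R; lra.
Qed.

Lemma dist_Nis x y n : Nis x y n -> dist x y = (/ INR d ^ n)%R.
Proof.
move=> Nn; rewrite /dist; case: excluded_middle_informative => [ex|[]]; last by exists n.
by case: constructive_indefinite_description => m Nm /=; rewrite (Nis_uniq Nn Nm).
Qed.

Lemma dist_refl x : dist x x = 0%R.
Proof.
by rewrite /dist; case: excluded_middle_informative => // ex; have [n /Nis_irrefl] := ex.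
Qed.

Lemma dist_le_agree x y n : (dist x y <= / INR d ^ n)%R <-> agree n x y.
Proof.
case: (eq_or_Nis x y) => [->|[m Nm]].
  rewrite dist_refl; split=> // _.
  exact: Rlt_le (Rinv_0_lt_compat _ (dpow_gt0 n)).
by rewrite (dist_Nis Nm) (Nis_agree n Nm) dpow_inv_le.
Qed.

Lemma ball_agree x y n : ball x (/ INR d ^ n)%R y <-> agree n x y.
Proof. exact: dist_le_agree. Qed.

Lemma ball_open x y z (r : R) n :
  (/ INR d ^ n <= r)%R -> ball x r y -> agree n y z -> ball x r z.
Proof.
rewrite /ball => ler bxy eyz.
case: (eq_or_Nis x z) => [->|[m Nxz]].
  by rewrite dist_refl; have := Rinv_0_lt_compat _ (dpow_gt0 n); lra.
case: (ltnP m n) => [lt_mn|le_nm].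
  rewrite (dist_Nis Nxz).
  by rewrite -(dist_Nis (Nis_ultra lt_mn Nxz (agree_sym eyz))).
by apply: Rle_trans ler; rewrite (dist_Nis Nxz); apply/dpow_inv_le.
Qed.

Definition isometry a := forall n x y, agree n (a x) (a y) <-> agree n x y.

Lemma isometry_Nis a : isometry a -> forall x y n, Nis (a x) (a y) n <-> Nis x y n.
Proof. by move=> iso x y; apply: agree_iff_Nis => n; rewrite iso. Qed.

Lemma IsAutE a : IsAut a <-> bijective a /\ isometry a.
Proof.
split=> -[bij iso]; split=> //.
  by move=> n x y; rewrite -!dist_le_agree iso.
move=> x y; case: (eq_or_Nis x y) => [->|[n Nn]]; first by rewrite !dist_refl.
by rewrite (dist_Nis Nn) (dist_Nis (n := n)) //; apply/(isometry_Nis iso).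
Qed.

Lemma Aut_inv a b : IsAut a -> cancel a b -> cancel b a -> IsAut b.
Proof.
move=> /IsAutE[_ iso] ab ba; apply/IsAutE; split; first by exists a.
by move=> n x y; rewrite -(iso n (b x)) !ba.
Qed.

Lemma Aut_comp a b : IsAut a -> IsAut b -> IsAut (a \o b).
Proof.
move=> [bija isoa] [bijb isob]; split; first exact: bij_comp.
by move=> x y /=; rewrite isoa isob.
Qed.

Lemma involution_Aut a : involutive a -> isometry a -> IsAut a.
Proof. by move=> inv iso; apply/IsAutE; split=> //; exists a. Qed.

(* Exchanges the n-th digits of [x] and [y] at every level [n], whatever the
   other digits are: an isometric involution exchanging [x] and [y]. *)
Definition swap x y u : ray :=
  (tperm x.1 y.1 u.1, fun j => tperm (x.2 j) (y.2 j) (u.2 j)).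

Lemma swapK x y : involutive (swap x y).
Proof.
by move=> u; apply/ray_eqP => -[|j]; rewrite /= tpermK.
Qed.

Lemma swap_isometry x y : isometry (swap x y).
Proof.
have dig j u v : (digit (swap x y u) j = digit (swap x y v) j) <-> digit u j = digit v j.
  by case: j => [|j] /=; split=> [/val_inj/perm_inj->|/val_inj->].
by move=> n u v; rewrite !agreeP; split=> e j lj; apply/dig; exact: e.
Qed.

Lemma digit_swapD x y u j :
  digit u j <> digit x j -> digit u j <> digit y j -> digit (swap x y u) j = digit u j.
Proof.
by case: j => [|j] /= nx ny; rewrite tpermD //; apply/eqP => e;
  [apply: nx|apply: ny|apply: nx|apply: ny]; rewrite e.
Qed.

Lemma digit_swap_id x y u j : digit x j = digit y j -> digit (swap x y u) j = digit u j.
Proof.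
by case: j => [|j] /= /val_inj ->; rewrite tperm1 perm1.
Qed.

Lemma swapL x y : swap x y x = y.
Proof. by apply/ray_eqP => -[|j]; rewrite /= tpermL. Qed.

Lemma swap_agree n x y u : agree n x y -> agree n u (swap x y u).
Proof.
by move=> /agreeP e; apply/agreeP => j lj; rewrite digit_swap_id ?e.
Qed.

Lemma swap_Aut x y : IsAut (swap x y).
Proof. exact: involution_Aut (@swapK x y) (@swap_isometry x y). Qed.

(** * Isometries of restricted support and homogeneity *)

Definition restrict (S : ray -> Prop) f u : ray :=
  if excluded_middle_informative (S u) then f u else u.

Lemma restrict_in (S : ray -> Prop) f u : S u -> restrict S f u = f u.
Proof. by rewrite /restrict; case: excluded_middle_informative. Qed.

Lemma restrict_out (S : ray -> Prop) f u : ~ S u -> restrict S f u = u.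
Proof. by rewrite /restrict; case: excluded_middle_informative. Qed.

(** Only pairs with one point in [S] and one outside need care; the last hypothesis is exactly what
    they require. *)
Lemma restrict_Aut (S : ray -> Prop) f :
  involutive f -> isometry f -> (forall u, S u -> S (f u)) ->
  (forall u v n, S u -> ~ S v -> agree n (f u) v <-> agree n u v) ->
  involutive (restrict S f) /\ IsAut (restrict S f).
Proof.
move=> inv iso stab out; have invr : involutive (restrict S f).
  move=> u; case: (classic (S u)) => Su; last by rewrite !(restrict_out f Su).
  by rewrite (restrict_in f Su) restrict_in ?inv //; exact: stab.
split=> //; apply: involution_Aut => // n u v.
case: (classic (S u)) => Su; case: (classic (S v)) => Sv;
  rewrite ?(restrict_in f Su) ?(restrict_out f Su) ?(restrict_in f Sv) ?(restrict_out f Sv) //.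
- exact: out.
- by split=> /agree_sym e; apply: agree_sym; apply/(out v u n Sv Su).
Qed.

Lemma local_swap n y z : agree n y z ->
  exists a, [/\ IsAut a, involutive a, a y = z &
    forall u, ~ agree n y u -> a u = u].
Proof.
move=> eyz; pose S u := agree n y u.
have stab u : S u -> S (swap y z u).
  by move=> Su; apply: agree_trans Su (swap_agree _ eyz).
have [|inv aut] := @restrict_Aut S (swap y z) (@swapK y z) (@swap_isometry y z) stab.
  move=> u v m Su Sv; have esu := swap_agree u eyz.
  have [i [lti Ni]] : exists i, (i < n)%N /\ Nis v u i.
    by apply: not_agree_Nis => evu; apply: Sv; apply: agree_trans Su (agree_sym evu).
  have Ni' := Nis_sym (Nis_ultra lti Ni esu).
  by rewrite (Nis_agree m Ni') (Nis_agree m (Nis_sym Ni)).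
exists (restrict S (swap y z)); split=> //.
  by rewrite restrict_in ?swapL //; exact: agree_refl.
by move=> u Su; rewrite restrict_out.
Qed.

(** The swap of [z] and [u] is restricted to the sphere of points branching from [y] at level [n].
    It preserves that sphere: it changes no digit before [n], and the [n]-th digit of [y] differs
    from those of [z] and [u], so is kept. *)
Lemma stabilizer_move n y z u : Nis y z n -> Nis y u n ->
  exists a, [/\ IsAut a, a y = y, a z = u & forall v, ~ agree n y v -> a v = v].
Proof.
move=> Nz Nu; pose S v := Nis y v n.
have ezu : agree n z u by apply: agree_trans (agree_sym (proj1 Nz)) (proj1 Nu).
have fixn : digit (swap z u y) n = digit y n.
  apply: digit_swapD => e.
    by apply: (proj2 Nz); apply/agreeS; split=> //; case: Nz.
  by apply: (proj2 Nu); apply/agreeS; split=> //; case: Nu.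
have efix : agree n.+1 y (swap z u y) by apply/agreeS; split=> //; exact: swap_agree.
have stab v : S v -> S (swap z u v).
  move=> /(isometry_Nis (@swap_isometry z u) y v n) Sv.
  by apply: Nis_sym; apply: Nis_ultra (Nis_sym Sv) (agree_sym efix).
have [|inv aut] := @restrict_Aut S (swap z u) (@swapK z u) (@swap_isometry z u) stab.
  move=> v w m Sv Sw; have Sv' := stab _ Sv.
  have evv := swap_agree v ezu.
  (* A point off the sphere is either closer to [y], thus at level [n] from the whole sphere, or
     branches off before level [n]. *)
  case: (classic (agree n y w)) => [eyw|neyw].
    have eyw' : agree n.+1 y w by apply: NNPP => ne; apply: Sw.
    rewrite (Nis_agree m (Nis_ultra (ltnSn n) (Nis_sym Sv) eyw')).
    by rewrite (Nis_agree m (Nis_ultra (ltnSn n) (Nis_sym Sv') eyw')).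
  have [i [lti Ni]] : exists i, (i < n)%N /\ Nis w v i.
    apply: not_agree_Nis => ewv; apply: neyw.
    by apply: agree_trans (proj1 Sv) (agree_sym ewv).
  have Ni' := Nis_sym (Nis_ultra lti Ni evv).
  by rewrite (Nis_agree m Ni') (Nis_agree m (Nis_sym Ni)).
exists (restrict S (swap z u)); split=> //.
- by rewrite restrict_out // => /Nis_irrefl.
- by rewrite restrict_in ?swapL.
by move=> v nv; rewrite restrict_out // => -[].
Qed.

Lemma two_point_homogeneous x y x' y' n : Nis x y n -> Nis x' y' n ->
  exists a, [/\ IsAut a, a x = x' & a y = y'].
Proof.
move=> N N'; have Ns : Nis x' (swap x x' y) n.
  by rewrite -{1}(swapL x x'); apply/(isometry_Nis (@swap_isometry x x')).
have [a [aut fix_x move_y _]] := stabilizer_move Ns N'.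
exists (a \o swap x x'); split=> /=; rewrite ?swapL //.
exact: Aut_comp aut (swap_Aut _ _).
Qed.

Definition other n (i : 'I_n) (n_gt1 : (1 < n)%N) : 'I_n :=
  if (i == 0 :> nat) then Ordinal n_gt1 else Ordinal (ltnW n_gt1).

Lemma otherP n (i : 'I_n) n_gt1 : other i n_gt1 <> i.
Proof.
by rewrite /other; case: eqP => e /(congr1 val) /=; rewrite ?e // => /esym.
Qed.

Definition set_digit x n (b : 'I_d) : ray := (x.1, fun j => if j == n then b else x.2 j).

Lemma set_digit_agree x n b : agree n.+1 x (set_digit x n b).
Proof. by split=> //= j lj; case: eqP => // e; lia. Qed.

Lemma digit_set_digit x n b : digit (set_digit x n b) n.+1 = b.
Proof. by rewrite /= eqxx. Qed.

Lemma exists_Nis x n : exists y, Nis x y n.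
Proof.
case: n => [|n].
  exists (other x.1 k_gt1, x.2); split=> // -[/= e _].
  by apply: (otherP (i := x.1) (n_gt1 := k_gt1)).
exists (set_digit x n (other (x.2 n) d_gt1)); split; first exact: set_digit_agree.
move=> /agreeS[_]; rewrite digit_set_digit => /val_inj e.
by apply: (otherP (i := x.2 n) (n_gt1 := d_gt1)).
Qed.

(** * Local scales of almost automorphisms *)

(** On the ball of level [M] around [x], [g] is a homothety of ratio $d^{-c}$; working with levels
    keeps real numbers out of the later arguments. *)
Definition scales M g x (c : Z) := forall y z i, agree M x y -> agree M x z ->
  Nis y z i -> exists i', Nis (g y) (g z) i' /\ Z.of_nat i' = (Z.of_nat i + c)%Z.

Definition locally_scaling g := exists M, forall x, exists c, scales M g x c.

Lemma scales_le M M' g x c : (M <= M')%N -> scales M g x c -> scales M' g x c.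
Proof. by move=> le sc y z i ey ez; apply: sc; exact: agree_le le _. Qed.

(** A pair branching at level [M] is sent to one branching at level [M + c], which is a natural
    number. *)
Lemma scales_ge M g x c : scales M g x c -> (- Z.of_nat M <= c)%Z.
Proof.
move=> sc; have [y Ny] := exists_Nis x M.
have [//||i [_]] := sc x y M _ _ Ny; first by case: Ny.
by lia.
Qed.

Lemma scales_uniq M M' g x c c' : scales M g x c -> scales M' g x c' -> c = c'.
Proof.
move=> sc sc'; have [y Ny] := exists_Nis x (M + M').
have [//||i [Ni ei]] := sc x y _ _ _ Ny; first by apply/(Nis_agree _ Ny); lia.
have [//||j [Nj ej]] := sc' x y _ _ _ Ny; first by apply/(Nis_agree _ Ny); lia.
by have := Nis_uniq Ni Nj; lia.
Qed.

(** By [scales_ge] the branching level drops by at most [M], and the other [M] keeps [y] in the ball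
    where [g] scales. *)
Lemma scales_continuous M g x c n y :
  scales M g x c -> agree (M + M + n)%N x y -> agree n (g x) (g y).
Proof.
move=> sc exy; case: (eq_or_Nis x y) => [->//|[i Ni]].
have lei := proj1 (Nis_agree _ Ni) exy; have := scales_ge sc.
have [//||j [Nj ej]] := sc x y i _ _ Ni; first by apply: agree_le exy; lia.
by move=> ?; apply/(Nis_agree _ Nj); lia.
Qed.

Lemma scales_comp M M' g h x c c' :
  scales M g x c -> scales M' h (g x) c' -> scales (M + M + M') (h \o g) x (c + c').
Proof.
move=> sc sc' y z i ey ez Ni.
have [||j [Nj ej]] := sc y z i _ _ Ni; [apply: agree_le ey; lia|apply: agree_le ez; lia|].
have [||l [Nl el]] := sc' (g y) (g z) j _ _ Nj.
- exact: scales_continuous sc _.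
- exact: scales_continuous sc _.
by exists l; split=> //; lia.
Qed.

Lemma scales_isometry a x : isometry a -> scales 0 a x 0.
Proof.
by move=> iso y z i _ _ Ni; exists i; split; [apply/isometry_Nis|lia].
Qed.

Lemma scales_comp_isometry M g a x c :
  isometry a -> scales M g (a x) c -> scales M (g \o a) x c.
Proof.
move=> iso sc y z i ey ez Ni; apply: sc; first exact/iso.
  exact/iso.
exact/(isometry_Nis iso).
Qed.

Lemma locally_scaling_continuous g n : locally_scaling g ->
  exists m, forall x y, agree m x y -> agree n (g x) (g y).
Proof.
move=> [M sc]; exists (M + M + n)%N => x y; have [c scx] := sc x.
exact: scales_continuous scx.
Qed.

Lemma continuous_map_agree g :
  (forall n, exists m, forall x y, agree m x y -> agree n (g x) (g y)) ->
  continuous_map g.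
Proof.
move=> cont x eps /dpow_inv_small[n small]; have [m cm] := cont n.
exists (/ INR d ^ m)%R; split; first exact: Rinv_0_lt_compat (dpow_gt0 m).
move=> y lt_xy; apply: Rle_lt_trans small; apply/dist_le_agree; apply: cm.
by apply/dist_le_agree; lra.
Qed.

Lemma isometry_continuous a : isometry a -> continuous_map a.
Proof.
by move=> iso; apply: continuous_map_agree => n; exists n => x y exy; apply/iso.
Qed.

Lemma IsAAut_bij g : IsAAut g -> exists2 g', cancel g g' & cancel g' g.
Proof. by move=> [[g' [gg' [g'g _]]] _]; exists g'. Qed.

(** The ratio is a priori any positive real; a single pair branching at level [M] forces it to be a
    power of $d$, and so fixes the scale. *)
Lemma homothety_scales (B : ray -> Prop) g x M : injective g ->
  homothety_on B g -> (forall y, agree M x y -> B y) -> exists c, scales M g x c.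
Proof.
move=> inj [C [C0 hom]] sub; have [y0 N0] := exists_Nis x M.
have img y z i : Nis y z i -> exists i', Nis (g y) (g z) i'.
  move=> Ni; case: (eq_or_Nis (g y) (g z)) => // /inj e.
  by case: (Nis_irrefl (x := z) (n := i)); rewrite -{1}e.
have eqC y z i i' : agree M x y -> agree M x z -> Nis y z i -> Nis (g y) (g z) i' ->
    (INR d ^ i = C * INR d ^ i')%R.
  move=> ey ez Ni Ni'; have := hom y z (sub y ey) (sub z ez).
  rewrite (dist_Nis Ni) (dist_Nis Ni').
  have := dpow_gt0 i; have := dpow_gt0 i' => p' p e.
  have -> : (C = C * / INR d ^ i * INR d ^ i)%R by field; lra.
  by rewrite -e; field; lra.
have [j Nj] := img _ _ _ N0.
exists (Z.of_nat j - Z.of_nat M)%Z => y z i ey ez Ni; have [i' Ni'] := img _ _ _ Ni.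
exists i'; split=> //.
have e0 := eqC x y0 M j (agree_refl _ _) (proj1 N0) N0 Nj.
have ei := eqC y z i i' ey ez Ni Ni'.
have : (i + j)%N = (M + i')%N.
  apply: dpow_inj; rewrite !pow_add ei e0; ring.
by lia.
Qed.

Lemma IsAAut_locally_scaling g : IsAAut g -> locally_scaling g.
Proof.
move=> aag; have [g' gg' _] := IsAAut_bij aag.
case: aag => [_ [n [c [r [prop [cov [_ hom]]]]]]].
have [|i ltin|M smallM] :=
    @bound_on_prefix (fun i m => (/ INR d ^ m <= r i)%R) n.
- by move=> i m m' le_m; apply: Rle_trans; apply/dpow_inv_le.
- by have [/dpow_inv_small[m]] := prop i ltin; exists m; lra.
exists M => x; have [i [ltin bx]] := cov x.
apply: homothety_scales (can_inj gg') (hom i ltin) _ => y.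
exact: ball_open (smallM i ltin) bx.
Qed.

Lemma scales_homothety M g x c : scales M g x c -> homothety_on (agree M x) g.
Proof.
(* This is $d^{-c}$: [Z.to_nat] sends negative integers to 0, so at most one factor differs from
   1. *)
move=> sc; exists (INR d ^ Z.to_nat (- c) * / INR d ^ Z.to_nat c)%R; split.
  by apply: Rmult_lt_0_compat (dpow_gt0 _) (Rinv_0_lt_compat _ (dpow_gt0 _)).
move=> y z ey ez; case: (eq_or_Nis y z) => [->|[i Ni]].
  by rewrite !dist_refl Rmult_0_r.
have [i' [Ni' ei']] := sc y z i ey ez Ni.
rewrite (dist_Nis Ni) (dist_Nis Ni').
have : (INR d ^ i * INR d ^ Z.to_nat c = INR d ^ i' * INR d ^ Z.to_nat (- c))%R.
  by rewrite -!pow_add; congr (_ ^ _)%R; lia.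
have := dpow_gt0 i; have := dpow_gt0 i'.
have := dpow_gt0 (Z.to_nat c); have := dpow_gt0 (Z.to_nat (- c)).
move: (INR d ^ i)%R (INR d ^ i')%R (INR d ^ Z.to_nat c)%R (INR d ^ Z.to_nat (- c))%R.
move=> A B C D D0 C0 B0 A0 e; apply: (Rmult_eq_reg_l (A * B * C)%R); last first.
  by have := Rmult_lt_0_compat _ _ (Rmult_lt_0_compat _ _ A0 B0) C0; lra.
have -> : (A * B * C * / B = A * C)%R by field; lra.
by rewrite e; field; lra.
Qed.

(** * The finitely many vertices of level [M.+1] and the partition into their balls *)

Definition vertex M : finType := ('I_k * {ffun 'I_M -> 'I_d})%type.

Definition vertex_of M x : vertex M := (x.1, [ffun i : 'I_M => x.2 i]).

Definition d0 : 'I_d := Ordinal (ltnW d_gt1).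
Definition d1 : 'I_d := Ordinal d_gt1.
Definition k0 : 'I_k := Ordinal (ltnW k_gt1).
Definition k1 : 'I_k := Ordinal k_gt1.

Definition ray_through M (v : vertex M) : ray :=
  (v.1, fun j => if insub j is Some i then v.2 i else d0).

Lemma ray_throughK M : cancel (@ray_through M) (@vertex_of M).
Proof.
move=> [v1 v2]; congr (_, _); apply/ffunP => i.
by rewrite ffunE /= valK.
Qed.

Lemma vertex_of_agree M x y : vertex_of M x = vertex_of M y <-> agree M.+1 x y.
Proof.
split=> [[e1 /ffunP e2]|[e1 e2]].
  by split=> // j lj; have := e2 (Ordinal lj); rewrite !ffunE.
by congr (_, _) => //; apply/ffunP => i; rewrite !ffunE e2.
Qed.

Lemma agree_ray_through M x : agree M.+1 x (ray_through (vertex_of M x)).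
Proof. by apply/vertex_of_agree; rewrite ray_throughK. Qed.

Lemma locally_scaling_IsAAut g : homeomorphism g -> locally_scaling g -> IsAAut g.
Proof.
move=> homeo [M sc]; split=> //.
pose v0 := vertex_of M (k0, fun=> d0).
pose V i := nth v0 (enum (vertex M)) i.
(* Level [M.+1] rather than [M] makes the balls proper even when [M] is 0. *)
exists #|vertex M|, (fun i => ray_through (V i)), (fun=> / INR d ^ M.+1)%R.
have ballV i x : ball (ray_through (V i)) (/ INR d ^ M.+1)%R x <-> V i = vertex_of M x.
  by rewrite ball_agree -vertex_of_agree ray_throughK.
split.
  move=> i _; split; first exact: Rinv_0_lt_compat (dpow_gt0 _).
  have [y [_ ny]] := exists_Nis (ray_through (V i)) 0.
  by exists y => /ball_agree e; apply: ny; exact: agree_le e.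
split.
  move=> x; exists (index (vertex_of M x) (enum (vertex M))); split.
    by rewrite cardE index_mem mem_enum.
  by apply/ballV; rewrite /V nth_index // mem_enum.
split.
  move=> i j x lti ltj neij /ballV ei /ballV ej.
  have /eqP : V i = V j by rewrite ei ej.
  by rewrite nth_uniq -?cardE ?enum_uniq // => /eqP.
move=> i lti; have [c sci] := sc (ray_through (V i)).
have [C [C0 hom]] := scales_homothety sci.
by exists C; split=> // y z /ball_agree ey /ball_agree ez; apply: hom;
  [apply: agree_le ey; lia|apply: agree_le ez; lia].
Qed.

Lemma IsAAut_comp_Aut g a : IsAAut g -> IsAut a -> IsAAut (g \o a).
Proof.
move=> aag auta; have [[a' aa' a'a] isoa] := proj1 (IsAutE a) auta.
have [_ isoa'] := proj1 (IsAutE a') (Aut_inv auta aa' a'a).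
apply: locally_scaling_IsAAut.
  case: aag => -[g' [gg' [g'g [cg cg']]]] _.
  have ccomp f1 f2 : continuous_map f1 -> continuous_map f2 ->
      continuous_map (f1 \o f2 : ray -> ray).
    move=> c1 c2 x e e0; have [e1 [e10 h1]] := c1 (f2 x) e e0.
    have [e2 [e20 h2]] := c2 x e1 e10.
    by exists e2; split=> // y /h2/h1.
  exists (a' \o g'); split; first exact: can_comp.
  split; first exact: can_comp.
  by split; apply: ccomp => //; exact: isometry_continuous.
have [M sc] := IsAAut_locally_scaling aag; exists M => x.
by have [c scx] := sc (a x); exists c; exact: scales_comp_isometry.
Qed.

(** * An almost automorphism exchanging balls of consecutive levels *)

Definition zeros n (s : nat -> 'I_d) := [forall i : 'I_n, s i == d0].

Lemma zerosP n s : reflect (forall i, (i < n)%N -> s i = d0) (zeros n s).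
Proof.
apply: (iffP forallP) => [z i lti|z i]; first exact: (eqP (z (Ordinal lti))).
by apply/eqP/z.
Qed.

(* Exchanges the ball of level [n.+1] of the rays [0 0^n w] with the ball of
   level [n.+2] of the rays [1 0^n.+1 w]. *)
Definition exchange n x : ray :=
  if (x.1 == k0) && zeros n x.2 then (k1, fun j => if j is j'.+1 then x.2 j' else d0)
  else if (x.1 == k1) && zeros n.+1 x.2 then (k0, fun j => x.2 j.+1)
  else x.

Definition base_ray : ray := (k0, fun=> d0).
Definition base_ray1 : ray := (k1, fun=> d0).

Lemma base_agree n x : agree n.+1 base_ray x <-> (x.1 == k0) && zeros n x.2.
Proof.
split=> [[/= <- e]|/andP[/eqP e /zerosP z]].
  by rewrite eqxx; apply/zerosP => i lti; rewrite -e.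
by split=> //= j lj; rewrite z.
Qed.

Lemma base1_agree n x : agree n.+1 base_ray1 x <-> (x.1 == k1) && zeros n x.2.
Proof.
split=> [[/= <- e]|/andP[/eqP e /zerosP z]].
  by rewrite eqxx; apply/zerosP => i lti; rewrite -e.
by split=> //= j lj; rewrite z.
Qed.

Lemma exchange_in n x : agree n.+1 base_ray x ->
  exchange n x = (k1, fun j => if j is j'.+1 then x.2 j' else d0).
Proof. by rewrite /exchange => /base_agree->. Qed.

Lemma exchange_in1 n x : agree n.+2 base_ray1 x ->
  exchange n x = (k0, fun j => x.2 j.+1).
Proof. by rewrite /exchange => /base1_agree/andP[/eqP-> ->]. Qed.

Lemma exchange_out n x : ~ agree n.+1 base_ray x -> ~ agree n.+2 base_ray1 x ->
  exchange n x = x.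
Proof.
rewrite /exchange => nb nb1.
by case: ifP => [/base_agree//|_]; case: ifP => [/base1_agree|].
Qed.

Lemma exchange_in_agree n x : agree n.+1 base_ray x -> agree n.+2 base_ray1 (exchange n x).
Proof.
move=> bx; rewrite exchange_in //; case: bx => _ e; split=> // -[|j] lj //=.
by rewrite -e.
Qed.

Lemma exchange_in1_agree n x : agree n.+2 base_ray1 x -> agree n.+1 base_ray (exchange n x).
Proof.
by move=> bx; rewrite exchange_in1 //; case: bx => _ e; split=> // j lj /=; rewrite -e.
Qed.

Lemma exchangeK n : involutive (exchange n).
Proof.
move=> x; case: (classic (agree n.+1 base_ray x)) => [bx|nbx].
  rewrite (exchange_in1 (exchange_in_agree bx)) (exchange_in bx).
  by case: bx => /= e _; apply/ray_eqP => -[|j] //=; rewrite -e.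
case: (classic (agree n.+2 base_ray1 x)) => [bx|nbx1].
  rewrite (exchange_in (exchange_in1_agree bx)) (exchange_in1 bx).
  case: bx => /= e e2; apply/ray_eqP => -[|[|j]] //=; first by rewrite -e.
  by rewrite -e2.
by rewrite !(exchange_out nbx nbx1).
Qed.

Lemma exchange_agree n m x y : agree n.+1 base_ray x -> agree n.+1 base_ray y ->
  agree m.+1 (exchange n x) (exchange n y) <-> agree m x y.
Proof.
move=> bx by_; rewrite !exchange_in //.
have e1 : digit x 0 = digit y 0 by case: bx by_ => /= <- _ [/= <- _].
rewrite !agreeP; split=> e [|j] lj //; first exact: (e j.+2).
by case: j lj => [|j] lj //=; have := e j.+1 lj.
Qed.

Lemma exchange_Nis n x y i : agree n.+1 base_ray x -> agree n.+1 base_ray y ->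
  Nis (exchange n x) (exchange n y) i.+1 <-> Nis x y i.
Proof. by move=> bx by_; rewrite /Nis !exchange_agree. Qed.

Lemma scales_exchange_in n x : agree n.+1 base_ray x -> scales n.+1 (exchange n) x 1.
Proof.
move=> bx y z i ey ez Ni; exists i.+1; split; last by lia.
by apply/exchange_Nis => //; exact: agree_trans bx _.
Qed.

Lemma scales_exchange_in1 n x : agree n.+2 base_ray1 x -> scales n.+2 (exchange n) x (-1).
Proof.
move=> bx y z i ey ez Ni.
have by_ : agree n.+2 base_ray1 y by exact: agree_trans bx _.
have bz : agree n.+2 base_ray1 z by exact: agree_trans bx _.
have lei : (n.+2 <= i)%N.
  by apply/(Nis_agree _ Ni); apply: agree_trans (agree_sym ey) ez.
case: i lei Ni => // i lei Ni; exists i; split; last by lia.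
by apply/(@exchange_Nis n); rewrite ?exchangeK //; exact: exchange_in1_agree.
Qed.

Lemma scales_exchange_out n x : ~ agree n.+1 base_ray x -> ~ agree n.+2 base_ray1 x ->
  scales n.+2 (exchange n) x 0.
Proof.
have out y : ~ agree n.+1 base_ray x -> ~ agree n.+2 base_ray1 x -> agree n.+2 x y ->
    exchange n y = y.
  move=> nb nb1 exy; apply: exchange_out => b; [apply: nb|apply: nb1].
    by apply: agree_trans b _; apply: agree_sym; apply: agree_le exy.
  by apply: agree_trans b _; apply: agree_sym.
move=> nb nb1 y z i ey ez Ni; exists i; split; last by lia.
by rewrite !out.
Qed.

Lemma exchange_IsAAut n : IsAAut (exchange n).
Proof.
have sc : locally_scaling (exchange n).
  exists n.+2 => x; case: (classic (agree n.+1 base_ray x)) => [bx|nbx].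
    by exists 1%Z; apply: scales_le (scales_exchange_in bx).
  case: (classic (agree n.+2 base_ray1 x)) => [bx|nbx1].
    by exists (-1)%Z; apply: scales_exchange_in1 bx.
  by exists 0%Z; apply: scales_exchange_out.
apply: locally_scaling_IsAAut => //.
have cont : continuous_map (exchange n).
  by apply: continuous_map_agree => m; exact: locally_scaling_continuous.
by exists (exchange n); split; [|split]; try exact: exchangeK.
Qed.

(** * Local ellipticity: elements of [H] have scale zero *)

Section Subgroup.
Variable H : gset d k.
Hypotheses (subH : IsSubgroup H) (AutH : forall g, IsAut g -> H g).

Lemma H_IsAAut h : H h -> IsAAut h.
Proof. by case: subH => + _; apply. Qed.

Lemma H_comp g h : H g -> H h -> H (g \o h).
Proof. by case: subH => _ [_ [+ _]]; apply. Qed.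

Lemma H_inv h : H h -> exists h', [/\ cancel h h', cancel h' h & H h'].
Proof.
move=> Hh; have [h' hh' h'h] := IsAAut_bij (H_IsAAut Hh).
by exists h'; split=> //; case: subH => _ [_ [_ +]]; apply; first exact: Hh.
Qed.

(** These open cosets form the cover to which compactness is applied in [scales_ge0]. *)
Definition Aut_coset g : gset d k := fun h => IsAAut g /\ exists2 a, IsAut a & h = g \o a.

Lemma Aut_coset_open g : IsOpen (Aut_coset g).
Proof.
split=> [_ [aag [a auta ->]]|_ [aag [a auta ->]]]; first exact: IsAAut_comp_Aut.
exists 0 => b [autb _]; split=> //; exists (a \o b) => //; exact: Aut_comp.
Qed.

Lemma id_Aut : IsAut (@id ray).
Proof. by apply: involution_Aut => // n x y. Qed.

Section Elliptic.
Hypothesis ellH : locally_elliptic H.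

(* A negative scale at [x] can be iterated after returning [h x] to [x] by an
   isometry; on the other hand all elements of a coset [t Aut] have scales
   bounded below by a constant depending on [t] only. *)
Lemma scales_ge0 h x M c : H h -> scales M h x c -> (0 <= c)%Z.
Proof.
move=> Hh sc; apply: Znot_gt_le => c_lt0.
pose f := swap (h x) x \o h.
have Hf : H f by apply: H_comp => //; apply: AutH; exact: swap_Aut.
have fx : f x = x by rewrite /f /= swapL.
have [M1 scf] : exists M1, scales M1 f x c.
  have := scales_comp sc (scales_isometry (x := h x) (@swap_isometry (h x) x)).
  by rewrite Z.add_0_r; eexists; eassumption.
have scf_iter n : exists Mn, scales Mn (iter n f) x (Z.of_nat n * c).
  elim: n => [|n [Mn scn]]; first by exists 0; apply: scales_isometry.
  have fix_n : iter n f x = x by elim: n {scn} => //= n ->.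
  exists (Mn + Mn + M1)%N; have := scales_comp scn (h := f) (M' := M1) (c' := c).
  rewrite fix_n => /(_ scf).
  by have -> : (Z.of_nat n * c + c = Z.of_nat n.+1 * c)%Z by lia.
have gen n : generated [:: f] (iter n f).
  move=> S [_ [S1 [Smul _]]] Sf; elim: n => [//|n IHn].
  by apply: (Smul f (iter n f)) => //; apply: Sf; left.
have Hiter n : H (iter n f) by apply: (gen n H subH) => g [<-|].
have [_ /(_ _ Aut_coset Aut_coset_open)] := ellH (F := [:: f]) ltac:(by move=> g [<-|]).
case=> [g [aag _]|F covF].
  by exists g; split=> //; exists id => //; exact: id_Aut.
have [t m m' le_m P aat|t _|K boundK] :=
    @bound_on_list _ (fun t m => IsAAut t -> forall x, exists c, scales m t x c) F.
- by move=> y; have [e sce] := P aat y; exists e; exact: scales_le sce.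
- case: (classic (IsAAut t)) => [aat|naat]; last by exists 0.
  by have [m scm] := IsAAut_locally_scaling aat; exists m.
(* By [scales_ge] the representatives in [F] have scales at least [-K], while this iterate has scale
   at most [-(K + 1)] at [x]. *)
have [|t [Ft [aat [a auta eqt]]]] := covF (iter K.+1 f).
  split; first exact: H_IsAAut.
  by move=> U _ Uf; exists (iter K.+1 f).
have [e sce] := boundK t Ft aat (a x).
have [Mn scn] := scf_iter K.+1.
have isoa := proj2 (proj1 (IsAutE a) auta).
have := scales_comp_isometry isoa sce; rewrite -eqt => sce'.
have := scales_uniq scn sce'; have := scales_ge sce'.
by nia.
Qed.

(** The inverse of [h] has the opposite scale at [h x], and both are nonnegative. *)
Lemma scales_eq0 h x M c : H h -> scales M h x c -> c = 0%Z.
Proof.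
move=> Hh sc; have [h' [hh' h'h Hh']] := H_inv Hh.
have [M' /(_ (h x))[c' sc']] := IsAAut_locally_scaling (H_IsAAut Hh').
have iso_id : isometry (h' \o h) by move=> n y z /=; rewrite !hh'.
have := scales_uniq (scales_comp sc sc') (scales_isometry (x := x) iso_id).
have := scales_ge0 Hh sc; have := scales_ge0 Hh' sc'; lia.
Qed.

(** Here [M] depends on [h]; [H_coarse_isometry] makes it uniform. *)
Lemma local_isometry h : H h -> exists M, forall n x y, (M <= n)%N ->
  agree n (h x) (h y) <-> agree n x y.
Proof.
have half g : H g -> exists M, forall n x y, (M <= n)%N -> agree n x y -> agree n (g x) (g y).
  move=> Hg; have [M sc] := IsAAut_locally_scaling (H_IsAAut Hg).
  exists M => n x y leMn exy; case: (eq_or_Nis x y) => [->//|[i Ni]].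
  have [c scx] := sc x; have c0 := scales_eq0 Hg scx.
  have lei := proj1 (Nis_agree _ Ni) exy.
  have [//||j [Nj ej]] := scx x y i _ _ Ni; first exact: agree_le exy.
  by apply/(Nis_agree _ Nj); lia.
move=> Hh; have [h' [hh' h'h Hh']] := H_inv Hh.
have [M hM] := half h Hh; have [M' hM'] := half h' Hh'.
exists (M + M')%N => n x y le; split; last by apply: hM; lia.
by move=> /hM'; rewrite !hh'; apply; lia.
Qed.

(** * Equicontinuity *)

Section Commensurated.
Hypothesis comH : commensurated H.

Lemma exchange_scale n x : exists2 c, scales n.+2 (exchange n) x c &
  c = (-1)%Z <-> agree n.+2 base_ray1 x.
Proof.
case: (classic (agree n.+1 base_ray x)) => [bx|nbx].
  exists 1%Z; first exact: scales_le (scales_exchange_in bx).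
  by split=> // -[/= e _]; case: bx => /= e' _; move: e; rewrite -e'.
case: (classic (agree n.+2 base_ray1 x)) => [bx|nbx1].
  by exists (-1)%Z; [exact: scales_exchange_in1|].
by exists 0%Z; [exact: scales_exchange_out|split].
Qed.

Lemma base_exchange n x : agree n.+2 base_ray1 (exchange n x) <-> agree n.+1 base_ray x.
Proof.
split; last exact: exchange_in_agree.
by move=> /exchange_in1_agree; rewrite exchangeK.
Qed.

(* Elements of [H] and of its conjugate have scale [0] and [exchange n] has
   scale [-1] exactly on the second ball. *)
Lemma conj_preserves_ball n q u : H q -> conjset (exchange n) H q ->
  agree n.+1 base_ray (q u) <-> agree n.+1 base_ray u.
Proof.
move=> Hq [h [g' [Hh [_ [g'g eqq]]]]].
have g'E v : g' v = exchange n v by rewrite -{2}(g'g v) exchangeK.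
have eqq' : q \o exchange n = exchange n \o h.
  by apply: functional_extensionality => v; rewrite eqq /= g'E exchangeK.
pose x := exchange n u.
have [c sc cE] := exchange_scale n x; have [c' sc' cE'] := exchange_scale n (h x).
have [Mq /(_ (exchange n x))[cq scq]] := IsAAut_locally_scaling (H_IsAAut Hq).
have [Mh /(_ x)[ch sch]] := IsAAut_locally_scaling (H_IsAAut Hh).
have eqc : c = c'.
  have := scales_comp sc scq; rewrite eqq' => sc1.
  have := scales_uniq sc1 (scales_comp sch sc').
  by have := scales_eq0 Hq scq; have := scales_eq0 Hh sch; lia.
rewrite -!base_exchange -/x -cE eqc cE'.
suff -> : exchange n (q u) = h x by [].
by rewrite eqq /= exchangeK g'E.
Qed.

(** An isometry [a] brings [h x] to the base ray, and the inverse of [a \o h] is [t \o q] with [t]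
    among finitely many coset representatives. As [q] preserves the base ball, the continuity of
    [q \o a \o h], the inverse of [t], passes to [h]. *)
Lemma equicontinuous n : exists m, forall h x y, H h -> agree m x y -> agree n (h x) (h y).
Proof.
case: n => [|n]; first by exists 0.
have [[s [sH cov]] _] := comH (exchange_IsAAut n).
have [t m m' le_m P|t st|m boundm] := @bound_on_list _ (fun t m => forall t' x y,
    cancel t t' -> cancel t' t -> agree m x y -> agree n.+1 (t' x) (t' y)) s.
- by move=> t' x y tt' t't exy; apply: P => //; apply: agree_le exy.
- have [t' [tt' t't Ht']] := H_inv (sH t st).
  have [m cm] := locally_scaling_continuous n.+1 (IsAAut_locally_scaling (H_IsAAut Ht')).
  exists m => t2 x y tt2 t2t exy.
  have t2E v : t2 v = t' v by rewrite -{2}(t2t v) tt'.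
  by rewrite !t2E; apply: cm.
exists m => h x y Hh exy; pose a := swap (h x) base_ray.
have Ha : H a by apply: AutH; exact: swap_Aut.
have [f [hf fh Hf]] := H_inv (H_comp Ha Hh).
have [t [q [st [[conjq Hq] eqf]]]] := cov f Hf.
have [t' [tt' t't Ht']] := H_inv (sH t st).
have qE v : t' v = q (a (h v)).
  by have := hf v; rewrite eqf /= => {1}<-; rewrite tt'.
have pres v := conj_preserves_ball v Hq conjq.
have bx : agree n.+1 base_ray (t' x) by rewrite qE pres /a swapL; exact: agree_refl.
have := agree_trans bx (boundm t st t' x y tt' t't exy); rewrite qE pres => by_.
by apply/(@swap_isometry (h x) base_ray); rewrite -/a /a swapL.
Qed.

(** * Elements supported in a small ball *)

Definition supported_in n x0 p := forall u, ~ agree n x0 u -> p u = u.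

Lemma supported_stable n x0 p u : injective p -> supported_in n x0 p ->
  agree n x0 u -> agree n x0 (p u).
Proof. by move=> inj sup bu; apply: NNPP => nb; apply: (nb); rewrite (inj _ _ (sup _ nb)). Qed.

Fixpoint chain (P : nat -> ray -> ray) j l : ray -> ray :=
  if l is l'.+1 then P j \o chain P j.+1 l' else id.

Lemma chain_cat P j l l' u : chain P j (l + l') u = chain P j l (chain P (j + l) l' u).
Proof.
elim: l j => [|l IHl] j /=; first by rewrite addn0.
by rewrite IHl addSnnS.
Qed.

Lemma chain_fix P j l u : (forall i, (j <= i < j + l)%N -> P i u = u) -> chain P j l u = u.
Proof.
elim: l j => [//|l IHl] j fixP /=; rewrite IHl; first by apply: fixP; lia.
by move=> i lei; apply: fixP; lia.
Qed.

Lemma H_chain P j l : (forall i, H (P i)) -> H (chain P j l).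
Proof.
by move=> HP; elim: l j => [|l IHl] j /=; [apply: AutH; exact: id_Aut|exact: H_comp].
Qed.

(** Centres for the copies of a rigid move: all lie in the ball of level 1 that [exchange 0] shifts,
    and deep balls around the first few are disjoint. *)
Definition spot j := set_digit base_ray j d1.

Lemma spot_inj m i j : (i.+1 < m)%N -> agree m (spot i) (spot j) -> i = j.
Proof.
move=> ltim /agreeP /(_ _ ltim); rewrite /= eqxx.
by case: eqP.
Qed.

(* Among the partial products of commuting elements supported in disjoint balls,
   two have conjugates in the same coset of [H]. *)
Lemma commuting_copies : exists N, forall P : nat -> ray -> ray, (forall i, H (P i)) ->
  exists i l, (i + l < N)%N /\ H (exchange 0 \o chain P i l.+1 \o exchange 0).
Proof.
have [_ [s [sC cov]]] := comH (exchange_IsAAut 0).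
exists (size s) => P HP; pose b i := exchange 0 \o chain P 0 i \o exchange 0.
have Cb i : conjset (exchange 0) H (b i).
  exists (chain P 0 i), (exchange 0); split; first exact: H_chain.
  by split; [exact: exchangeK|split; [exact: exchangeK|]].
have dec i : exists t, List.In t s /\ exists2 a, H a & b i = t \o a.
  by have [t [a [st [[_ Ha] eqb]]]] := cov (b i) (Cb i); exists t; split=> //; exists a.
pose col i := proj1_sig (constructive_indefinite_description _ (dec i)).
have colP i : List.In (col i) s /\ exists2 a, H a & b i = col i \o a.
  by rewrite /col; case: constructive_indefinite_description.
have [i [j [lij eqcol]]] := @list_pigeonhole _ s col (fun i _ => proj1 (colP i)).
exists i, (j - i).-1; split; first by lia.
have -> : (j - i).-1.+1 = (j - i)%N by lia.
have [st [a Ha eqbi]] := colP i; have [_ [a2 Ha2 eqbj]] := colP j.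
have [a' [aa' a'a Ha']] := H_inv Ha.
(* The conjugated chain carries [b i] to [b j] by right composition; cancelling the common
   representative [col i] leaves [a' \o a2]. *)
suff -> : exchange 0 \o chain P i (j - i) \o exchange 0 = a' \o a2 by exact: H_comp.
have injt : injective (col i).
  have [h [g' [Hh [gg' [g'g ->]]]]] := sC _ st; have [h' [hh' _ _]] := H_inv Hh.
  exact: inj_comp (can_inj gg') (inj_comp (can_inj hh') (can_inj g'g)).
apply: functional_extensionality => w; apply: (can_inj aa').
rewrite /= a'a; apply: injt.
have := congr1 (fun f => f (exchange 0 (chain P i (j - i) (exchange 0 w)))) eqbi.
rewrite /= => <-; rewrite eqcol; have := congr1 (fun f => f w) eqbj; rewrite /= => <-.
rewrite /b /= exchangeK; congr (exchange 0 _).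
have {2}-> : j = (i + (j - i))%N by lia.
by rewrite chain_cat.
Qed.

Definition rigid_move n m m' := exists p x0 y z, [/\ H p, supported_in n x0 p,
  agree n x0 y /\ agree n x0 z, Nis y z m & Nis (p y) (p z) m'].

Lemma rigid_move_sym n m m' : rigid_move n m m' -> rigid_move n m' m.
Proof.
move=> [p [x0 [y [z [Hp sup [by_ bz] N N']]]]]; have [q [pq qp Hq]] := H_inv Hp.
exists q, x0, (p y), (p z); split=> //; last by rewrite !pq.
  by move=> u /sup {1}<-; rewrite pq.
by split; apply: supported_stable => //; exact: can_inj pq.
Qed.

(* The element produced by [commuting_copies] acts on the ball of level [n.+1]
   around [x1] as a copy of [p], but also on other balls. Its commutator with an
   isometry moving that ball inside the ball of level [n] around [x1] is
   supported in the latter. *)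
Lemma rigid_move_shift : exists n0, forall n m m', (n0 <= n)%N ->
  rigid_move n m m' -> rigid_move n m.+1 m'.+1.
Proof.
(* The margin lets level [n.-1] separate all spots of index below [N]. *)
have [N copies] := commuting_copies; exists N.+3 => n m m' leNn.
move=> [p [x0 [y [z [Hp supp [by_ bz] Nyz Npyz]]]]].
pose a j := swap x0 (spot j); pose P j := a j \o p \o a j.
have Ha j : H (a j) by apply: AutH; exact: swap_Aut.
have HP j : H (P j) by apply: H_comp => //; exact: H_comp.
have spotE j : a j x0 = spot j by exact: swapL.
have isoa j : isometry (a j) by exact: swap_isometry.
have aK j : involutive (a j) by exact: swapK.
have supP j : supported_in n (spot j) (P j).
  move=> u nb; rewrite /P /= supp ?aK // => b; apply: nb.
  by rewrite -spotE -(aK j u); apply/isoa.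
have [i [l [ltN Hf]]] := copies P HP.
set f := exchange 0 \o chain P i l.+1 \o exchange 0 in Hf.
have [f' [ff' f'f Hf']] := H_inv Hf.
pose x1 := exchange 0 (spot i).
have bspot j : agree 1 base_ray (spot j) by exact: agree_le (set_digit_agree _ _ _).
have lift u r : (2 <= r)%N -> agree r x1 u ->
    [/\ agree 1 base_ray (exchange 0 u), u = exchange 0 (exchange 0 u)
      & agree r.-1 (spot i) (exchange 0 u)].
  move=> le2r bu; have b1 : agree 2 base_ray1 u.
    by apply: agree_trans (exchange_in_agree (bspot i)) _; exact: agree_le bu.
  have b2 := exchange_in1_agree b1; split=> //; first by rewrite exchangeK.
  apply/(exchange_agree _ (bspot i) b2); rewrite exchangeK.
  by apply: agree_le bu; lia.
have away j v : (i <= j < i + l.+1)%N -> agree n.-1 (spot i) v -> agree n (spot j) v -> j = i.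
  move=> lej bi bj; symmetry; apply: (@spot_inj n.-1); first by lia.
  by apply: agree_trans bi _; apply: agree_sym; apply: agree_le bj; lia.
have f_in u : agree n.+1 x1 u -> f u = exchange 0 (P i (exchange 0 u)).
  move=> bu; have [|b1 uE bsp] := lift u n.+1 _ bu; first by lia.
  rewrite /f /= chain_fix // => j lej; apply: supP => bj.
  by have := away j _ _ (agree_le _ bsp) bj; lia.
(* The exchange takes such [u] into the ball of level [n.-1] around [spot i], which meets the
   support of no factor but [P i], and outside the support of [P i] itself. *)
have f_out u : agree n x1 u -> ~ agree n.+1 x1 u -> f u = u.
  move=> bu nbu; have [|b1 uE bsp] := lift u n _ bu; first by lia.
  rewrite /f [RHS]uE [LHS]/=; congr (exchange 0 _).
  rewrite -[LHS]/(chain P i l.+1 (exchange 0 u)) chain_fix // => j lej.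
  apply: supP => bj; have eji : j = i by apply: away bj.
  by apply: nbu; rewrite uE; apply/exchange_agree => //; rewrite -eji.
have injP : injective (P i) by have [P' [PP' _ _]] := H_inv (HP i); exact: can_inj PP'.
have f_stable u : agree n x1 u -> agree n x1 (f u).
  move=> bu; case: (classic (agree n.+1 x1 u)) => [bu1|nbu]; last by rewrite f_out.
  have [|b1 uE bsp] := lift u n.+1 _ bu1; first by lia.
  have bP := supported_stable injP (@supP i) bsp.
  rewrite f_in //; apply: (@agree_le n n.+1) => //.
  by apply/exchange_agree => //; apply: agree_trans (bspot i) _; apply: agree_le bP; lia.
have [z1 Nz1] := exists_Nis x1 n.
have [b [autb bK bx1 supb]] := local_swap (proj1 Nz1).
have isob := proj2 (proj1 (IsAutE b) autb).
pose q := f \o b \o f' \o b.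
(* [b] moves [u] near [z1], where [f] and hence [f'] are the identity, and then back. *)
have q_in u : agree n.+1 x1 u -> q u = f u.
  move=> bu; rewrite /q /=.
  have bz1 : agree n.+1 z1 (b u) by rewrite -bx1; apply/isob.
  have fb : f (b u) = b u.
    apply: f_out; first by apply: agree_trans (proj1 Nz1) _; exact: agree_le bz1.
    by move=> b1; apply: (proj2 Nz1); apply: agree_trans b1 (agree_sym bz1).
  by rewrite -{1}fb ff' bK.
exists q, x1, (exchange 0 (a i y)), (exchange 0 (a i z)).
have ball_a u : agree n x0 u -> agree n (spot i) (a i u) by rewrite -spotE; move/(isoa i).
have base_a u : agree n x0 u -> agree 1 base_ray (a i u).
  by move=> /ball_a bu; apply: agree_trans (bspot i) _; apply: agree_le bu; lia.
have ball_ex u : agree n x0 u -> agree n.+1 x1 (exchange 0 (a i u)).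
  by move=> bu; apply/exchange_agree => //; [exact: base_a|exact: ball_a].
have q_copy u : agree n x0 u -> q (exchange 0 (a i u)) = exchange 0 (a i (p u)).
  by move=> bu; rewrite q_in ?f_in ?exchangeK; rewrite /P /= ?aK //; exact: ball_ex.
have injp : injective p by have [p' [pp' _ _]] := H_inv Hp; exact: can_inj pp'.
have ball_p u : agree n x0 u -> agree n x0 (p u) by exact: supported_stable.
have Hb := AutH autb.
split.
- by do 3!apply: H_comp => //.
- move=> u nbu; rewrite /q /= (supb u) // supb ?f'f // => bf.
  by apply: nbu; rewrite -(f'f u); exact: f_stable.
- by split; apply: (@agree_le n n.+1) => //; exact: ball_ex.
- by apply/exchange_Nis; [exact: base_a..|apply/(isometry_Nis (isoa i))].
rewrite !q_copy //; apply/exchange_Nis; [exact: base_a (ball_p _ _)..|].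
exact/(isometry_Nis (isoa i)).
Qed.

(** By two-point homogeneity an isometry matches the two pairs branching at level [m2]. *)
Lemma move_trans m1 m2 m3 :
  (exists h y z, [/\ H h, Nis y z m1 & Nis (h y) (h z) m2]) ->
  (exists h y z, [/\ H h, Nis y z m2 & Nis (h y) (h z) m3]) ->
  exists h y z, [/\ H h, Nis y z m1 & Nis (h y) (h z) m3].
Proof.
move=> [h [y [z [Hh N1 N2]]]] [h2 [y2 [z2 [Hh2 N2' N3]]]].
have [a [auta ay az]] := two_point_homogeneous N2 N2'.
exists (h2 \o a \o h), y, z; split=> //=; last by rewrite ay az.
by do 2!apply: H_comp => //; exact: AutH.
Qed.

Lemma rigid_move_eq : exists n0, forall m m', rigid_move n0 m m' -> m = m'.
Proof.
have [n0 shift] := rigid_move_shift; exists n0.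
suff no_move m m' : rigid_move n0 m m' -> (m' < m)%N -> False.
  move=> m m' mv; case: (ltngtP m m') => // lt_m; exfalso; last exact: no_move lt_m.
  exact: no_move (rigid_move_sym mv) lt_m.
move=> mv lt_m.
have shifts e : rigid_move n0 (m + e) (m' + e).
  by elim: e => [|e IHe]; rewrite ?addn0 ?addnS //; exact: shift.
(* Shifted copies of the move compose, each lowering the level by [m - m']: pairs as close as
   desired are spread to the fixed level [m']. *)
have iterate t : exists h y z, [/\ H h, Nis y z (m' + t * (m - m'))%N & Nis (h y) (h z) m'].
  elim: t => [|t IHt].
    have [z Nz] := exists_Nis base_ray m'; exists id, base_ray, z.
    by rewrite mul0n addn0; split=> //; apply: AutH; exact: id_Aut.
  apply: move_trans IHt; have [p [x0 [y [z [Hp _ _ N N']]]]] := shifts (t * (m - m'))%N.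
  exists p, y, z; split=> //.
  by have -> : (m' + t.+1 * (m - m') = m + t * (m - m'))%N by rewrite mulSn; lia.
have [M eqM] := equicontinuous m'.+1.
have [h [y [z [Hh N N']]]] := iterate M.
have : agree m'.+1 (h y) (h z).
  apply: eqM => //; apply/(Nis_agree _ N).
  by have : (M * 1 <= M * (m - m'))%N by [rewrite leq_mul2l; lia]; lia.
by case: N'.
Qed.

Lemma Nis_isometry p : (forall x y i, Nis x y i -> Nis (p x) (p y) i) -> isometry p.
Proof.
move=> pres n x y; case: (eq_or_Nis x y) => [->|[i Ni]]; first by split.
by rewrite (Nis_agree n Ni) (Nis_agree n (pres _ _ _ Ni)).
Qed.

(** Pairs inside the ball are handled by [rigid_move_eq]; a mixed pair branches before level [n0],
    and [p] moves its inner point only within the ball. *)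
Lemma rigid_isometry : exists n0, forall p x0, H p -> supported_in n0 x0 p -> isometry p.
Proof.
have [n0 mv_eq] := rigid_move_eq; exists n0 => p x0 Hp sup; apply: Nis_isometry.
have injp : injective p by have [p' [pp' _ _]] := H_inv Hp; exact: can_inj pp'.
have mixed x y i : agree n0 x0 x -> ~ agree n0 x0 y -> Nis x y i -> Nis (p x) (p y) i.
  move=> bx nby Ni; rewrite (sup y nby); apply: Nis_sym.
  apply: (@Nis_ultra _ x _ _ n0); last first.
  - by apply: agree_trans (agree_sym bx) _; exact: supported_stable.
  - exact: Nis_sym.
  rewrite ltnNge; apply/negP => le_n0; apply: nby; apply: agree_trans bx _.
  exact/(Nis_agree _ Ni).
move=> x y i Ni; case: (classic (agree n0 x0 x)) => bx; case: (classic (agree n0 x0 y)) => by_.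
- case: (eq_or_Nis (p x) (p y)) => [/injp e|[j Nj]].
    by case: (Nis_irrefl (x := y) (n := i)); rewrite -{1}e.
  by rewrite (mv_eq i j) //; exists p, x0, x, y.
- exact: mixed.
- by apply: Nis_sym; apply: mixed => //; exact: Nis_sym.
by rewrite !sup.
Qed.

(** * Compactness *)

Definition coarse_isometry M h := forall n x y, (M <= n)%N ->
  agree n (h x) (h y) <-> agree n x y.

(* The images of the [d] children of the ball of level [i] around [x] are
   [d] distinct children of the ball of level [i] around [h x]. *)
Lemma children_surjective h i : (0 < i)%N ->
  (forall x y, agree i.+1 (h x) (h y) <-> agree i.+1 x y) ->
  (forall x y, agree i x y -> agree i (h x) (h y)) ->
  forall x y, agree i (h x) (h y) -> agree i x y.
Proof.
case: i => [//|i] _ isoS fwd x y exy.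
pose child b := set_digit x i b.
pose phi b := (h (child b)).2 i.
have hchild b : agree i.+1 (h x) (h (child b)) by apply: fwd; exact: set_digit_agree.
have inj : injective phi.
  move=> b b' eqphi; apply: val_inj.
  suff /agreeS[_] : agree i.+2 (child b) (child b') by rewrite !digit_set_digit.
  apply/isoS/agreeS; split; first exact: agree_trans (agree_sym (hchild b)) (hchild b').
  by rewrite /= -/(phi b) eqphi.
have [psi _ psiK] := injF_bij inj.
pose b := psi ((h y).2 i).
have /isoS eby : agree i.+2 (h (child b)) (h y).
  apply/agreeS; split; first exact: agree_trans (agree_sym (hchild b)) exy.
  by rewrite /= -/(phi b) psiK.
apply: agree_trans (set_digit_agree x i b) _; exact: agree_le eby.
Qed.

(* If [h] sent two children of the ball of level [i] around [y] too far apart,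
   some [w] near [h y] would be missed by [h] of that ball, hence be fixed by the
   isometries [h a h^-1], among which one exchanges [h y] and [h z]. *)
Lemma H_coarse_isometry : exists M, forall h, H h -> coarse_isometry M h.
Proof.
have [n0 rigid] := rigid_isometry; have [M equi] := equicontinuous n0.
exists M.+1 => h Hh; have [h' [hh' h'h Hh']] := H_inv Hh.
have conj_iso i y0 a : (M < i)%N -> IsAut a -> supported_in i y0 a ->
    isometry (h \o a \o h').
  move=> ltMi auta sup; apply: (rigid _ (h y0)).
    by do 2!apply: H_comp => //; exact: AutH.
  move=> u nb; rewrite /= sup ?h'h // => b; apply: nb.
  by rewrite -(h'h u); apply: equi => //; apply: agree_le b; lia.
have step i : (M < i)%N -> (forall x y, agree i.+1 (h x) (h y) <-> agree i.+1 x y) ->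
    forall x y, agree i (h x) (h y) <-> agree i x y.
  move=> ltMi isoS.
  have fwd y z : Nis y z i -> agree i (h y) (h z).
    move=> Nyz; apply: NNPP => /not_agree_Nis[i' [lti' Ni']].
    have [w Nw] := exists_Nis (h y) i.
    case: (classic (agree i y (h' w))) => [eyw|neyw].
      (* If [w] were not missed, an isometry fixing [y] and taking [z] to [h' w] would conjugate to
         an isometry fixing [h y] and taking [h z] to [w]; but these branch from [h y] at different
         levels. *)
      have Nyu : Nis y (h' w) i by split=> // /isoS; rewrite h'h; case: Nw.
      have [a [auta ay az sup]] := stabilizer_move Nyz Nyu.
      have := isometry_Nis (conj_iso _ _ _ ltMi auta sup) (h y) (h z) i'.
      rewrite /= !hh' ay az h'h => -[_ /(_ Ni')] Nw'.
      by have := Nis_uniq Nw Nw'; lia.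
    have [a [auta _ ay sup]] := local_swap (proj1 Nyz).
    have := conj_iso _ _ _ ltMi auta sup i (h y) w.
    rewrite /= hh' ay (sup _ neyw) h'h => -[_ /(_ (proj1 Nw)) ezw].
    have := agree_trans (proj1 Nw) (agree_sym ezw).
    by move/(Nis_agree _ Ni'); lia.
  have fwd' x y : agree i x y -> agree i (h x) (h y).
    move=> exy; case: (classic (agree i.+1 x y)) => [/isoS|nexy]; first exact: agree_le.
    exact: fwd.
  by move=> x y; split; [apply: children_surjective => //; lia|exact: fwd'].
(* Descend from [L], which depends on [h], to the uniform level [M.+1]. *)
have [L isoL] := local_isometry Hh.
suff down j n : (L <= n + j)%N -> (M < n)%N -> forall x y, agree n (h x) (h y) <-> agree n x y.
  by move=> n x y ltMn; apply: (down L); lia.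
elim: j n => [|j IHj] n leL ltMn x y; first by apply: isoL; lia.
by apply: step => // x' y'; apply: IHj; lia.
Qed.

(** From level [M] on, both maps preserve agreement; below it, [h' \o f] changes no digit. *)
Lemma coarse_factor M m h h' f f' : (M <= m)%N -> cancel h h' -> cancel h' h ->
  cancel f f' -> cancel f' f -> coarse_isometry M h -> coarse_isometry M f ->
  (forall x, agree m (h x) (f x)) -> Fix m (h' \o f).
Proof.
move=> leMm hh' h'h ff' f'f isoh isof ehf.
have near x : agree m x (h' (f x)) by apply/isoh => //; rewrite h'h.
split=> //; apply/IsAutE; split.
  by exists (f' \o h); [exact: can_comp|exact: can_comp].
move=> n x y /=; case: (leqP M n) => [leMn|ltnM].
  by rewrite -(isoh n) // !h'h isof.
have near_n u : agree n u (h' (f u)) by apply: agree_le (near u); lia.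
split=> e; first exact: agree_trans (near_n x) (agree_trans e (agree_sym (near_n y))).
exact: agree_trans (agree_sym (near_n x)) (agree_trans e (near_n y)).
Qed.

(** The digit of index [n] is taken from [s n.+1]; along a coherent sequence it is final from there
    on. *)
Definition ray_limit (s : nat -> ray) : ray := ((s 1).1, fun j => (s j.+2).2 j).

Lemma ray_limitP (s : nat -> ray) : (forall n, agree n (s n) (s n.+1)) ->
  forall n, agree n (ray_limit s) (s n).
Proof.
move=> coh; have later n l : agree n (s n) (s (n + l)).
  elim: l => [|l IHl]; first by rewrite addn0.
  by rewrite addnS; apply: agree_trans IHl _; apply: agree_le (coh _); lia.
move=> n; apply/agreeP => j ltjn.
have -> : digit (ray_limit s) j = digit (s j.+1) j by case: j ltjn.
have := later j.+1 (n - j.+1); have -> : (j.+1 + (n - j.+1) = n)%N by lia.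
by move/agreeP => /(_ j (ltnSn j)).
Qed.

(** * Finite subcovers and Koenig's lemma *)

Section Compact.
Variables (I : Type) (U : I -> gset d k).

Definition coverable (S : gset d k) :=
  exists F : seq I, forall h, S h -> exists i, List.In i F /\ U i h.

Lemma coverable_sub (S S' : gset d k) : (forall h, S h -> S' h) -> coverable S' -> coverable S.
Proof. by move=> sub [F cov]; exists F => h /sub/cov. Qed.

Lemma coverable_colors (T : finType) (col : (ray -> ray) -> T) (S : gset d k) :
  (forall c, coverable (fun h => S h /\ col h = c)) -> coverable S.
Proof.
move=> covc; suff [F cov] : coverable (fun h => S h /\ col h \in enum T).
  by exists F => h Sh; apply: cov; rewrite mem_enum.
elim: (enum T) => [|c s [F cov]]; first by exists [::] => h [].
have [F' cov'] := covc c; exists (F ++ F') => h [Sh]; rewrite inE => /orP[/eqP hc|hs].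
  by have [i [Fi Ui]] := cov' h (conj Sh hc); exists i; split=> //; apply: List.in_or_app; right.
by have [i [Fi Ui]] := cov h (conj Sh hs); exists i; split=> //; apply: List.in_or_app; left.
Qed.

Definition near n h : gset d k := fun h' => H h' /\ forall x, agree n (h x) (h' x).

Lemma not_coverable_near M n (S : gset d k) : (M <= n)%N ->
  (forall h, S h -> H h) -> (forall h, H h -> coarse_isometry M h) ->
  ~ coverable S -> exists2 h, S h & ~ coverable (near n h).
Proof.
move=> leMn SH iso ncov; apply: NNPP => nex; apply: ncov.
(* Finitely many colours: coarse isometries agreeing at level [n.+1] on one ray per vertex do so on
   all rays. *)
pose col h := [ffun v : vertex n => vertex_of n (h (ray_through v))].
apply: (coverable_colors (col := col)) => c.
case: (classic (exists2 h, S h & col h = c)) => [[h Sh hc]|none]; last first.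
  by exists [::] => h [Sh hc]; case: none; exists h.
apply: NNPP => ncov; apply: nex; exists h => // cov; apply: ncov.
apply: coverable_sub cov => h' [Sh' hc']; split; first exact: SH.
move=> x; apply: (@agree_le n n.+1) => //.
pose x' := ray_through (vertex_of n x).
have same : agree n.+1 (h x') (h' x').
  have /ffunP/(_ (vertex_of n x)) : col h = col h' by rewrite hc hc'.
  by rewrite !ffunE => /vertex_of_agree.
have move_x g : S g -> agree n.+1 (g x) (g x').
  by move=> Sg; apply/(iso g (SH g Sg)); [exact: leqW|exact: agree_ray_through].
exact: agree_trans (move_x h Sh) (agree_trans same (agree_sym (move_x h' Sh'))).
Qed.

End Compact.

Lemma H_compact : IsCompact H.
Proof.
split=> [h|I U openU covU]; first exact: H_IsAAut.
have [M iso] := H_coarse_isometry.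
rewrite -/(coverable U H); apply: NNPP => ncov.
pose bad n := {h | H h /\ ~ coverable U (near (M + n) h)}.
have start : bad 0.
  apply: constructive_indefinite_description.
  have [||h Hh nc] := not_coverable_near (n := (M + 0)%N) _ _ iso ncov => //.
    exact: leq_addr.
  by exists h.
have step n (s : bad n) : {s' : bad n.+1 | near (M + n) (sval s) (sval s')}.
  apply: constructive_indefinite_description; case: s => h [Hh nc].
  have [||h' nh' nc'] := not_coverable_near (n := (M + n.+1)%N) _ _ iso nc.
  - exact: leq_addr.
  - by move=> h' [].
  have bad_h' : H h' /\ ~ coverable U (near (M + n.+1) h') by case: nh'.
  by exists (exist _ h' bad_h').
pose s := nat_rect bad start (fun n b => sval (step n b)).
pose hs n := sval (s n).
have Hhs n : H (hs n) by case: (svalP (s n)).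
have cohM n x : agree (M + n) (hs n x) (hs n.+1 x) by case: (svalP (step n (s n))) => _; apply.
have coh n x : agree n (hs n x) (hs n.+1 x) by apply: agree_le (cohM n x); lia.
pose inv n := constructive_indefinite_description _ (H_inv (Hhs n)).
pose hs' n := sval (inv n).
have hsK n : cancel (hs n) (hs' n) by case: (svalP (inv n)).
have hs'K n : cancel (hs' n) (hs n) by case: (svalP (inv n)).
(* The inverses converge too, which makes the limit bijective; the offset [M] in [bad] allows [iso]
   to be used at every step. *)
have coh' n x : agree n (hs' n x) (hs' n.+1 x).
  apply: (@agree_le n (M + n)); first exact: leq_addl.
  apply/(iso _ (Hhs n)); first exact: leq_addr.
  by rewrite hs'K -{1}(hs'K n.+1 x); apply: agree_sym; exact: cohM.
pose f x := ray_limit (fun n => hs n x); pose f' x := ray_limit (fun n => hs' n x).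
have fE n x : agree n (f x) (hs n x) by exact: (ray_limitP (fun n => coh n x)).
have f'E n x : agree n (f' x) (hs' n x) by exact: (ray_limitP (fun n => coh' n x)).
have all_agree x y : (forall n, (M <= n)%N -> agree n x y) -> x = y.
  move=> e; case: (eq_or_Nis x y) => // -[i [_ []]].
  by apply: (@agree_le _ (M + i.+1)); [exact: leq_addl|apply: e; exact: leq_addr].
have fK : cancel f f'.
  move=> x; apply: all_agree => n leMn; apply: agree_trans (f'E n _) _.
  by apply/(iso _ (Hhs n)) => //; rewrite hs'K; exact: fE.
have f'K : cancel f' f.
  move=> x; apply: all_agree => n leMn; apply: agree_trans (fE n _) _.
  by rewrite -{2}(hs'K n x); apply/(iso _ (Hhs n)).
have isof : coarse_isometry M f.
  move=> n x y leMn; rewrite -(iso _ (Hhs n) n x y leMn).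
  split=> e; first exact: agree_trans (agree_sym (fE n x)) (agree_trans e (fE n y)).
  exact: agree_trans (fE n x) (agree_trans e (agree_sym (fE n y))).
have Hf : H f.
  have [auta _] : Fix M (hs' M \o f).
    apply: coarse_factor (hsK M) (hs'K M) fK f'K (iso _ (Hhs M)) isof _ => // x.
    exact: agree_sym.
  (* The limit differs from [hs M] by an isometry, and [H] contains all isometries. *)
  suff -> : f = hs M \o (hs' M \o f) by apply: H_comp => //; exact: AutH.
  by apply: functional_extensionality => x; rewrite /= hs'K.
have [i Uf] := covU f Hf; have [_ /(_ f Uf)[n openf]] := openU i.
(* Everything in [H] near [hs (M + n)] lies in the coset of [f] by [Fix n], so the single set [U i]
   covers it. *)
have [_ []] := svalP (s (M + n)%N).
exists [:: i] => h [Hh nearh]; exists i; split; first by left.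
have [h' [hh' h'h Hh']] := H_inv Hh.
have [auta faga] : Fix (M + n) (f' \o h).
  apply: coarse_factor fK f'K hh' h'h isof (iso _ Hh) _ => [|x]; first exact: leq_addr.
  by apply: agree_trans (fE _ x) _; apply: agree_le (nearh x); exact: leq_addl.
suff -> : h = f \o (f' \o h).
  by apply: openf; split=> // x; apply: agree_le (faga x); exact: leq_addl.
by apply: functional_extensionality => x; rewrite /= f'K.
Qed.

End Commensurated.
End Elliptic.
End Subgroup.
End Boundary.

Theorem mainTheorem14 (d k : nat) (H : gset d k) :
  (2 <= d)%N -> (2 <= k)%N ->
  IsSubgroup H ->
  locally_elliptic H ->
  commensurated H ->
  (forall g, IsAut g -> H g) ->
  IsCompact H.
Proof.
by move=> d_gt1 k_gt1 subH ellH comH AutH; exact: H_compact.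
Qed.
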